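(* Let $n,k$ be positive integers and let $g_1,\ldots,g_k \in \mathbb{R}[\mathbf{x}] \setminus \{0\}$, $\mathbf{x}=(x_1,\ldots,x_n)$, be such that the set $$X := \{x\in \mathbb{R}^n : g_1(x) \ge 0,\ldots,g_k(x) \ge 0\}$$ has non-empty interior. Let $d_0,\ldots,d_k$ be non-negative integers. Then, for the truncated quadratic module $$C= \Sigma_{n,2d_0} + g_1 \Sigma_{n,2 d_1} + \cdots + g_k \Sigma_{n,2 d_k},$$ one has $$\operatorname{sxdeg}(C) = \binom{n+d}{n}, \qquad\text{where } d := \max \{d_0,\ldots,d_k\}.$$
   Context: $\mathbb{R}[\mathbf{x}]$ is the ring of real polynomials in the variables $\mathbf{x}=(x_1,\ldots,x_n)$. A polynomial is SOS if it is a sum of finitely many squares of polynomials in $\mathbb{R}[\mathbf{x}]$. $\Sigma_{n,2d}$ is the set of all SOS polynomials in $\mathbb{R}[\mathbf{x}]$ of degree at most $2d$. For $g\in\mathbb{R}[\mathbf{x}]$ and $D\subseteq \mathbb{R}[\mathbf{x}]$, $gD := \{gp : p\in D\}$, and sums of sets are Minkowski sums. $\mathcal{S}^j$ is the vector space of real symmetric $j\times j$ matrices and $\mathcal{S}_+^j\subseteq \mathcal{S}^j$ is the cone of positive semidefinite ones. For a closed convex cone $K$ in a finite-dimensional real vector space $E$, a subset $S$ of a real vector space $V$ has a $K$-lift if $S = \pi(K \cap H)$ for some affine subspace $H$ of $E$ and some linear map $\pi: E \to V$. The semidefinite extension degree $\operatorname{sxdeg}(S)$ is the smallest positive integer $j$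 such that $S$ has an $(\mathcal{S}_+^j)^m$-lift for some finite positive integer $m$, where $(\mathcal{S}_+^j)^m = \mathcal{S}_+^j\times\cdots\times\mathcal{S}_+^j$ ($m$ factors); $\operatorname{sxdeg}(S):=\infty$ if there is no such $j$. *)

(* Defs.v *)
From HB Require Import structures.
From mathcomp Require Import all_boot all_order all_algebra.
(* mpoly must be imported before mathcomp-analysis: in the other order the
   levels of their notations are incompatible. *)
From mathcomp Require Import mpoly.
From mathcomp Require Import boolp classical_sets constructive_ereal reals.

Set Implicit Arguments.
Unset Strict Implicit.
Unset Printing Implicit Defensive.

Import Order.TTheory GRing.Theory Num.Theory.

Local Open Scope classical_set_scope.
Local Open Scope ring_scope.

Section Polynomials.
Variables (R : realType) (n : nat).

Definition is_sos (p : {mpoly R[n]}) : Prop :=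
  exists s : seq {mpoly R[n]}, p = \sum_(q <- s) q ^+ 2.

(* [msize p] is [deg p + 1] for [p != 0], and [msize 0 = 0]. *)
Definition Sigma (e : nat) : set {mpoly R[n]} :=
  [set p | is_sos p /\ (msize p <= e.+1)%N].

Definition mulr_set (g : {mpoly R[n]}) (D : set {mpoly R[n]}) :
  set {mpoly R[n]} := [set g * p | p in D].

Definition semialg_set k (g : 'I_k -> {mpoly R[n]}) : set 'rV[R]_n :=
  [set x : 'rV[R]_n | forall i, 0 <= (g i).@[fun j => x ord0 j]].

End Polynomials.

Section Minkowski.
Variable V : zmodType.

Definition mink_add (A B : set V) : set V := [set x + y | x in A & y in B].

Definition mink_sum k (A : 'I_k -> set V) : set V :=
  \big[mink_add/[set 0]]_(i < k) A i.

End Minkowski.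

(* The index [ord0] of [d] belongs to the summand without multiplier; the
   multiplier [g i] goes with the index [lift ord0 i], whose value is [i.+1]. *)
Definition truncated_qmodule (R : realType) n k (g : 'I_k -> {mpoly R[n]})
    (d : 'I_k.+1 -> nat) : set {mpoly R[n]} :=
  mink_add (Sigma (2 * d ord0))
    (mink_sum (fun i : 'I_k => mulr_set (g i) (Sigma (2 * d (lift ord0 i))))).

Section Lifts.
Variable R : realType.

Definition affine_subspace (E : vectType R) (H : set E) : Prop :=
  exists (a : E) (W : {vspace E}), H = [set a + w | w in [set` W]].

(* Meant for a closed convex cone [K]; below it is only applied to powers of
   the cone of positive semidefinite matrices. *)
Definition has_lift (E : vectType R) (K : set E) (V : lmodType R)
    (S : set V) : Prop :=
  exists (H : set E) (f : {linear E -> V}),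
    affine_subspace H /\ S = f @` (K `&` H).

Definition sym_mx j : {vspace 'M[R]_j} := fixedSpace (linfun (@trmx R j j)).

Definition psd_cone j : set (subvs_of (sym_mx j)) :=
  [set A | forall v : 'cV[R]_j, 0 <= (v^T *m vsval A *m v) ord0 ord0].

Definition psd_cone_power j m : set {ffun 'I_m -> subvs_of (sym_mx j)} :=
  [set A | forall i, psd_cone (A i)].

Definition has_psd_lift (V : lmodType R) (S : set V) (j : nat) : Prop :=
  exists2 m : nat, (0 < m)%N & has_lift (@psd_cone_power j m) S.

Definition sxdeg (V : lmodType R) (S : set V) : \bar nat :=
  match pselect (exists j : nat, (0 < j)%N && `[< has_psd_lift S j >]) with
  | left h => (ex_minn h)%:E
  | right _ => +oo%E
  end.

End Lifts.

(* Main.v *)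
Require Import Defs.
From HB Require Import structures.
From mathcomp Require Import all_boot all_order all_algebra.
From mathcomp Require Import mpoly.
From mathcomp Require Import boolp classical_sets constructive_ereal reals.
From mathcomp Require Import topology normedtype.
From mathcomp Require Import lra ring zify.

Set Implicit Arguments.
Unset Strict Implicit.
Unset Printing Implicit Defensive.

Import Order.TTheory GRing.Theory Num.Theory.
Import numFieldNormedType.Exports.

Local Open Scope classical_set_scope.
Local Open Scope ring_scope.

(** Write [D] for the largest of the [d i] and [b] for the number of monomials
of degree at most [D] in [n] variables, which is the binomial coefficient.

Upper bound.  In a sum of squares the leading coefficients cannot cancel, so a
sum of squares of degree at most [2 * d i] is a sum of squares of polynomials
of degree at most [d i].  Its elements are therefore the values at Gram matrices
of a linear map, and the quadratic module is the image of the product of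
[k + 1] cones of positive semidefinite matrices of size [b]: the affine
subspace can be the whole space, because principal submatrices of positive
semidefinite matrices are positive semidefinite ([truncated_qmodule_lift]).

Lower bound.  Suppose that there is a lift with [m] blocks of size [j < b].
Two facts are opposed to each other.

- The module has many zero patterns.  A nonzero polynomial of degree at most
  [D] vanishes on any given [b - 1] points, and arbitrarily many points of the interior of [X] are
  in general position: for [W] of size at most [b - 1] and [x] outside [W], some
  [f] of degree at most [D] vanishes on [W] and not at [x]
  ([general_position_near]).  If [D = d i], then the product of [f ^+ 2] with
  the multiplier of index [i] is in the module, with the same zeros among
  these points.

- A lift with small blocks has few zero patterns.  Evaluation at [x] is
  nonnegative on the module, so by conic duality its pullback to the lift is a
  functional [B x] that is nonnegative on all block tuples of positive
  semidefinite matrices ([dual_certificate]).  On rank one matrices [v^T *m v]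
  of the block [i] it is a positive semidefinite quadratic form in [v], whose
  zeros form a subspace [N x i] of a space of dimension [j].  If a member of the
  module vanishes on [W] but not at [x], then decomposing a preimage into
  rank one matrices yields a block [i] and a vector that lies in [N y i] for all
  [y] in [W] but not in [N x i] ([vanishing_witness]).  For a large set of
  points this is impossible when [j <= b - 1]: passing to points that treat
  each block alike, and intersecting with [N x0 i] for one of them, lowers
  both the dimension and the size of [W] ([separated_size]).

Duality needs a Slater point.  It exists relative to the smallest face of the
cone that contains the feasible set.  Instead of passing to that face, the cone
is enlarged to those tuples that are positive semidefinite on the range of a
feasible tuple [A0] of maximal rank; then [A0] is an interior point, no new
feasible tuples with range in that of [A0] arise, and the extension theorem of
M. Riesz applies. *)

(** * Positive semidefinite matrices *)

Section Psd.
Variable R : realType.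

Definition psd j (A : 'M[R]_j) : Prop :=
  forall v : 'cV[R]_j, 0 <= (v^T *m A *m v) ord0 ord0.

Lemma norm2_row r (u : 'cV[R]_r) :
  (u^T *m u) ord0 ord0 = \sum_i u i ord0 ^+ 2.
Proof. by rewrite mxE; apply: eq_bigr => i _; rewrite mxE expr2. Qed.

Lemma gram_psd r j (G : 'M[R]_(r, j)) : psd (G^T *m G).
Proof.
move=> v; rewrite mulmxA -trmx_mul -mulmxA norm2_row.
by apply: sumr_ge0 => i _; apply: sqr_ge0.
Qed.

(** The diagonal entries of the sum are sums of squares of the entries of [X]
and [Y]. *)
Lemma gram_sum_eq0 r s j (X : 'M[R]_(r, j)) (Y : 'M[R]_(s, j)) :
  X^T *m X + Y^T *m Y = 0 -> X = 0.
Proof.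
move=> /matrixP XY0; apply/matrixP => i l.
have := XY0 l l; rewrite !mxE => /eqP.
have sq p (Z : 'M[R]_(p, j)) : 0 <= \sum_a Z^T l a * Z a l.
  by apply: sumr_ge0 => a _; rewrite mxE -expr2 sqr_ge0.
rewrite paddr_eq0 // => /andP[/eqP /psumr_eq0P H _].
have ge0 a : true -> 0 <= X^T l a * X a l by rewrite mxE -expr2 sqr_ge0.
by have /eqP := H ge0 i isT; rewrite mxE -expr2 sqrf_eq0 => /eqP.
Qed.

Definition bil j (A : 'M[R]_j) (u v : 'cV[R]_j) : R := (u^T *m A *m v) ord0 ord0.

Lemma bilC j (A : 'M[R]_j) u v : A^T = A -> bil A u v = bil A v u.
Proof.
move=> symA; have -> : bil A v u = ((v^T *m A *m u)^T) ord0 ord0 by rewrite mxE.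
by rewrite !trmx_mul trmxK symA mulmxA.
Qed.

Lemma bilBl j (A : 'M[R]_j) u v w : bil A (u - v) w = bil A u w - bil A v w.
Proof. by rewrite /bil linearB !mulmxBl !mxE. Qed.

Lemma bilBr j (A : 'M[R]_j) u v w : bil A w (u - v) = bil A w u - bil A w v.
Proof. by rewrite /bil mulmxBr !mxE. Qed.

Lemma bilZl j (A : 'M[R]_j) c u w : bil A (c *: u) w = c * bil A u w.
Proof. by rewrite /bil linearZ -!scalemxAl !mxE. Qed.

Lemma bilZr j (A : 'M[R]_j) c u w : bil A w (c *: u) = c * bil A w u.
Proof. by rewrite /bil -!scalemxAr !mxE. Qed.

Lemma bil_delta j (A : 'M[R]_j) a c :
  bil A (delta_mx a ord0) (delta_mx c ord0) = A a c.
Proof. by rewrite /bil trmx_delta -rowE -colE !mxE. Qed.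

(** The new form at [v] is the old form at the point of the line
[v + R * delta_mx i ord0] where it is least. *)
Lemma psd_update j (A : 'M[R]_j) (i : 'I_j) : A^T = A -> psd A -> 0 < A i i ->
  psd (A - (A i i)^-1 *: (col i A *m (col i A)^T)).
Proof.
move=> symA psdA a_gt0 v; set a := A i i in a_gt0 *.
set e := delta_mx i ord0 : 'cV[R]_j.
have cE : col i A = A *m e by rewrite colE.
have sq : (v^T *m (col i A *m (col i A)^T) *m v) ord0 ord0 = bil A e v ^+ 2.
  rewrite cE trmx_mul symA expr2 {1}(bilC _ _ symA) /bil.
  have -> : v^T *m (A *m e *m (e^T *m A)) *m v =
      (v^T *m A *m e) *m (e^T *m A *m v) by rewrite !mulmxA.
  by rewrite [LHS]mxE big_ord1.
rewrite mulmxBr mulmxBl -scalemxAr -scalemxAl [X in 0 <= X]mxE.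
rewrite [X in _ + X]mxE [X in _ - X]mxE sq.
have := psdA (v - (a^-1 * bil A e v) *: e); rewrite -/(bil A _ _).
have aE : bil A e e = a by apply: bil_delta.
rewrite bilBl !bilBr !bilZl !bilZr aE (bilC v e symA).
set q := bil A v v; set b := bil A e v => h.
have -> : (v^T *m A *m v) ord0 ord0 = q by [].
have -> // : q - a^-1 * b ^+ 2 =
  q - a^-1 * b * b - (a^-1 * b * b - a^-1 * b * (a^-1 * b * a)).
by field; rewrite gt_eqF.
Qed.

Lemma psd_diag_ge0 j (A : 'M[R]_j) i : psd A -> 0 <= A i i.
Proof. by move=> /(_ (delta_mx i ord0)); rewrite -/(bil _ _ _) bil_delta. Qed.

(** Evaluate the form at [delta_mx a ord0 - A a c *: delta_mx c ord0]. *)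
Lemma psd_diag0 j (A : 'M[R]_j) : A^T = A -> psd A ->
  (forall i, A i i = 0) -> A = 0.
Proof.
move=> symA psdA A0; apply/matrixP => a c; rewrite [RHS]mxE.
have := psdA (delta_mx a ord0 - A a c *: delta_mx c ord0).
rewrite -/(bil _ _ _) bilBl !bilBr !bilZl !bilZr !bil_delta !A0.
have -> : A c a = A a c by rewrite -[in RHS]symA mxE.
by move=> h; apply/eqP; rewrite -sqrf_eq0; apply/eqP; nra.
Qed.

(** Cholesky elimination: subtracting a rank one matrix as in [psd_update]
annihilates the diagonal entry [i] and keeps those that are already zero. *)
Lemma psd_gram j (A : 'M[R]_j) : A^T = A -> psd A ->
  exists (r : nat) (G : 'M[R]_(r, j)), A = G^T *m G.
Proof.
have [N] := ubnP #|[pred i | A i i != 0]|.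
elim: N A => // N IH A ltN symA psdA.
case: (pickP [pred i | A i i != 0]) => [i /= Ai0|A0]; last first.
  exists 0%N, 0; rewrite mulmx0; apply: psd_diag0 => // i.
  by apply/eqP; have /= := A0 i; case: eqP.
have a_gt0 : 0 < A i i by rewrite lt_def Ai0 psd_diag_ge0.
set A' := A - (A i i)^-1 *: (col i A *m (col i A)^T).
have psdA' : psd A' by apply: psd_update.
have A'E l : A' l l = A l l - (A i i)^-1 * A l i ^+ 2.
  by rewrite !mxE big_ord1 !mxE expr2.
have symA' : A'^T = A' by rewrite linearB linearZ /= trmx_mul trmxK symA.
have [|r [G GE]] := IH A' _ symA' psdA'.
  apply: leq_trans (ltN : (_ <= N)%N).
  apply: proper_card; apply/properP; split; last first.
    by exists i; rewrite !inE // A'E expr2 mulrA mulVf // mul1r subrr eqxx.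
  apply/fintype.subsetP => l; rewrite !inE; apply: contra => /eqP l0.
  have := psd_diag_ge0 l psdA'; rewrite A'E l0 sub0r oppr_ge0 => h.
  rewrite eq_le; apply/andP; split.
    by rewrite oppr_le0 mulr_ge0 ?sqr_ge0 // invr_ge0 ltW.
  by rewrite oppr_ge0.
set c := (Num.sqrt (A i i))^-1 *: (col i A)^T.
exists (1 + r)%N, (col_mx c G).
have cT : c^T = (Num.sqrt (A i i))^-1 *: col i A by rewrite /c linearZ /= trmxK.
rewrite tr_col_mx mul_row_col -GE cT -scalemxAl -scalemxAr.
by rewrite scalerA -invfM -expr2 sqr_sqrtr ?ltW // addrC subrK.
Qed.

(** Row spaces are orthogonal complements of kernels, and the kernel of a sum
of Gram matrices lies in the kernel of each, by [gram_sum_eq0]. *)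
Lemma psd_add_submx j (A B : 'M[R]_j) : A^T = A -> B^T = B -> psd A -> psd B ->
  (A <= (A + B)%R)%MS.
Proof.
move=> symA symB psdA psdB; rewrite submxE.
have := mulmx_coker (A + B); move: (cokermx (A + B)) => Z ABZ.
have [r [G GE]] := psd_gram symA psdA; have [s [F FE]] := psd_gram symB psdB.
have GZ0 : G *m Z = 0.
  apply: (@gram_sum_eq0 r s _ _ (F *m Z)); rewrite !trmx_mul !mulmxA.
  move/(congr1 (mulmx Z^T)): ABZ.
  by rewrite mulmx0 mulmxDl mulmxDr GE FE !mulmxA.
by rewrite GE -mulmxA GZ0 mulmx0.
Qed.

Lemma sum_gram_rows r j (G : 'M[R]_(r, j)) :
  G^T *m G = \sum_a (row a G)^T *m row a G.
Proof.
apply/matrixP => a c; rewrite mxE summxE; apply: eq_bigr => i _.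
by rewrite !mxE big_ord1 !mxE.
Qed.

End Psd.

(** * Extension of positive functionals *)

Section Riesz.
Variables (R : realType) (E : vectType R).

(** A coordinate along the component [y - projv H y] of [y] outside [H]. *)
Lemma separating_functional (H : {vspace E}) (y : E) : y \notin H ->
  exists f : 'Hom(E, R^o), (forall h, h \in H -> f h = 0) /\ f y = 1.
Proof.
move=> yH; set z := y - projv H y.
have z0 : z != 0.
  by apply: contra yH; rewrite subr_eq0 => /eqP ->; apply: memv_proj.
pose f : 'Hom(E, R^o) := (linfun (coord [tuple z] ord0) \o (\1 - projv H))%VF.
have fE u : f u = coord [tuple z] ord0 (u - projv H u).
  by rewrite comp_lfunE lfunE /= add_lfunE opp_lfunE id_lfunE.
exists f; split=> [h hH|]; first by rewrite fE projv_id // subrr linear0.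
rewrite fE -/z; have := @coord_free _ _ _ [tuple z] ord0 ord0.
by rewrite /= => -> //; rewrite seq1_free.
Qed.

Definition convex_cone (K : set E) : Prop :=
  (forall u v, K u -> K v -> K (u + v)) /\
  (forall c u, 0 <= c -> K u -> K (c *: u)).

Definition algebraic_interior (K : set E) (e : E) : Prop :=
  forall y, exists2 t : R, 0 < t & K (e + t *: y).

Variables (K : set E) (e : E).
Hypotheses (coneK : convex_cone K) (intK : algebraic_interior K e).

(** The value [c] of the extension at [y] has to lie above [phi h] when
[y - h] is in [K] and below [phi h] when [h - y] is in [K].  The positivity of
[phi] makes these bounds compatible, and [e] shows that both kinds exist, so
the supremum of the lower bounds works. *)
Lemma riesz_step (H : {vspace E}) (phi : 'Hom(E, R^o)) (y : E) :
  e \in H -> (forall u, u \in H -> K u -> 0 <= phi u) -> y \notin H ->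
  exists2 psi : 'Hom(E, R^o), (forall u, u \in H -> psi u = phi u) &
    forall u, u \in (H + <[y]>)%VS -> K u -> 0 <= psi u.
Proof.
move=> eH phi_ge0 yH; have [KD KZ] := coneK.
pose L : set R := [set r | exists2 h, h \in H & K (y - h) /\ r = phi h].
have ubL h : h \in H -> K (h - y) -> ubound L (phi h).
  move=> hH Kh r [h' h'H [Kh' ->]]; rewrite -subr_ge0 -linearB.
  apply: phi_ge0; first exact: rpredB.
  by have := KD _ _ Kh Kh'; rewrite addrA subrK.
have L0 : L !=set0.
  have [t t0 Kt] := intK y; exists (phi (- (t^-1 *: e))).
  exists (- (t^-1 *: e)); first by rewrite rpredN rpredZ.
  split=> //; have := KZ t^-1 _ _ Kt; rewrite invr_ge0 ltW // => /(_ isT).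
  by rewrite scalerDr scalerA mulVf ?gt_eqF // scale1r opprK addrC.
have [t t0 Kt] := intK (- y).
have upL : has_ubound L.
  exists (phi (t^-1 *: e)); apply: ubL; first by rewrite rpredZ.
  have := KZ t^-1 _ _ Kt; rewrite invr_ge0 ltW // => /(_ isT).
  by rewrite scalerDr scalerA mulVf ?gt_eqF // scale1r.
have [f [f0 fy]] := separating_functional yH.
pose c := sup L; pose psi : 'Hom(E, R^o) := phi + (c - phi y) *: f.
have psiE u : psi u = phi u + (c - phi y) * f u.
  by rewrite add_lfunE scale_lfunE.
exists psi => [u uH|u]; first by rewrite psiE f0 // mulr0 addr0.
case/memv_addP => h hH [_ /vlineP[s ->] ->] Ku.
have psi_u : psi (h + s *: y) = phi h + s * c.
  rewrite psiE !linearD !linearZ /= f0 // fy add0r /GRing.scale /= mulr1.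
  ring.
rewrite psi_u; case: (ltgtP s 0) => s0; last first.
- move: Ku; rewrite s0 scale0r mul0r !addr0; exact: phi_ge0.
- have : phi (- (s^-1 *: h)) <= c.
    apply: ub_le_sup => //; exists (- (s^-1 *: h)).
      by rewrite rpredN rpredZ.
    split=> //; have := KZ s^-1 _ _ Ku; rewrite invr_ge0 ltW // => /(_ isT).
    by rewrite scalerDr scalerA mulVf ?gt_eqF // scale1r opprK addrC.
  rewrite linearN linearZ /= /GRing.scale /= -subr_ge0 opprK => h0.
  have -> : phi h + s * c = s * (c + s^-1 * phi h).
    by field; rewrite gt_eqF.
  by rewrite mulr_ge0 // ltW.
- have : c <= phi ((- s)^-1 *: h).
    apply: ge_sup => //; apply: ubL; first by rewrite rpredZ.
    have := KZ (- s)^-1 _ _ Ku.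
    rewrite invr_ge0 oppr_ge0 ltW // => /(_ isT).
    by rewrite scalerDr scalerA invrN mulNr mulVf ?lt_eqF // scaleN1r.
  rewrite linearZ /= /GRing.scale /= -subr_ge0 => h0.
  have -> : phi h + s * c = (- s) * ((- s)^-1 * phi h - c).
    by field; rewrite lt_eqF.
  by rewrite mulr_ge0 // oppr_ge0 ltW.
Qed.

(** The extension theorem of M. Riesz, by adding one dimension at a time. *)
Lemma riesz_extension (H : {vspace E}) (phi : 'Hom(E, R^o)) :
  e \in H -> (forall u, u \in H -> K u -> 0 <= phi u) ->
  exists2 psi : 'Hom(E, R^o), (forall u, u \in H -> psi u = phi u) &
    forall u, K u -> 0 <= psi u.
Proof.
have [N] := ubnP (\dim {:E} - \dim H)%N.
elim: N H phi => // N IH H phi ltN eH phi_ge0.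
have [HT|] := boolP ({:E} <= H)%VS.
  by exists phi => // u Ku; apply: phi_ge0 => //; apply: (subvP HT); rewrite memvf.
case/subvPn => y _ yH.
have [phi' phi'E phi'_ge0] := riesz_step eH phi_ge0 yH.
have sH : (H <= H + <[y]>)%VS by apply: addvSl.
have [|psi psiE psi_ge0] := IH _ phi' _ (subvP sH _ eH) phi'_ge0.
  rewrite (leq_trans _ (ltN : (_ <= N)%N)) //.
  have ltH : (\dim H < \dim (H + <[y]>))%N.
    rewrite (ltn_leqif (dimv_leqif_sup sH)); apply: contra yH => HyH.
    by apply/(subvP HyH)/(subvP (addvSr _ _)); apply: memv_line.
  by rewrite ltn_sub2l // (leq_trans ltH) ?dimvS ?subvf.
by exists psi => // u uH; rewrite psiE ?phi'E // (subvP sH).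
Qed.

End Riesz.

Section AffineRiesz.
Variables (R : realType) (E : vectType R).

(** The affine subspace [a + W] is put at height one in [E * R]; [level0] is the
embedding of the directions of [W], at height zero. *)
Definition level0 (w : E) : (E * R^o)%type := (w, 0).

Lemma level0_is_linear : linear level0.
Proof. by move=> c u v; congr pair; rewrite /= scaler0 addr0. Qed.

HB.instance Definition _ :=
  GRing.isLinear.Build R E (E * R^o)%type _ level0 level0_is_linear.

Lemma ge0_of_ge0_add (x y : R) : 0 <= y ->
  (forall s, 0 < s -> 0 <= x + s * y) -> 0 <= x.
Proof.
move=> y0 H; rewrite leNgt; apply/negP => x0.
have y1 : 0 < y + 1 by lra.
have := H (- x / (2 * (y + 1))); rewrite divr_gt0 ?mulr_gt0 ?oppr_gt0 //.
move=> /(_ isT).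
have -> : x + - x / (2 * (y + 1)) * y = x * ((y + 2) / (2 * (y + 1))).
  by field; rewrite gt_eqF.
by rewrite nmulr_rge0 // leNgt divr_gt0 // ?mulr_gt0 //; lra.
Qed.

Variables (K : set E) (a : E) (W : {vspace E}) (phi : 'Hom(E, R^o)).
Hypotheses (coneK : convex_cone K) (intK : algebraic_interior K a).

(** Homogenization of [riesz_extension]: it is applied to the cone
[K * [0, +oo[], the interior point [(a, 1)] and the span of [(a + W) * {1}].
The constant [c] is the value of the extension at the vertical vector
[(0, 1)]. *)
Lemma affine_riesz_extension :
  (forall w, w \in W -> K (a + w) -> 0 <= phi (a + w)) ->
  exists (B : 'Hom(E, R^o)) (c : R),
    [/\ 0 <= c, (forall Y, K Y -> 0 <= B Y) &
        forall w, w \in W -> phi (a + w) = B (a + w) + c].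
Proof.
move=> phi_ge0; have [KD KZ] := coneK.
have Ka : K a by have [t _] := intK 0; rewrite scaler0 addr0.
pose F : vectType R := (E * R^o)%type.
pose K2 : set F := [set u | K u.1 /\ 0 <= u.2].
have coneK2 : convex_cone K2.
  split=> [u v [Ku u0] [Kv v0]|c u c0 [Ku u0]]; split; rewrite /=.
  - exact: KD.
  - exact: addr_ge0.
  - exact: KZ.
  - exact: mulr_ge0.
pose a1 : F := (a, 1).
have intK2 : algebraic_interior K2 a1.
  move=> [Y r]; have [t t0 Kt] := intK Y.
  pose s := Num.min t (1 + `|r|)^-1.
  have r0 : 0 < 1 + `|r| by rewrite ltr_pwDl.
  have s0 : 0 < s by rewrite lt_min t0 invr_gt0.
  exists s => //; split => /=.
    have -> : a + s *: Y = (1 - s / t) *: a + (s / t) *: (a + t *: Y).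
      rewrite scalerDr scalerA divfK ?gt_eqF // addrA -scalerDl subrK.
      by rewrite scale1r.
    apply: KD; apply: KZ => //; last by rewrite divr_ge0 ?ltW.
    by rewrite subr_ge0 ler_pdivrMr // mul1r ge_min lexx.
  rewrite /GRing.scale /=; have : s * (1 + `|r|) <= 1.
    by rewrite -ler_pdivlMr // mul1r ge_min lexx orbT.
  have := ler_norm (- r); rewrite normrN => h1 h2; nra.
pose H2 : {vspace F} := (<[a1]> + linfun level0 @: W)%VS.
have inH2 s w : w \in W -> (s *: a + w, s) \in H2.
  move=> wW; have -> : (s *: a + w, s) = s *: a1 + linfun level0 w.
    by rewrite lfunE /=; congr pair; rewrite /= [s%:A]mulr1 addr0.
  by rewrite memv_add ?memvZ ?memv_line ?memv_img.
have a1H : a1 \in H2 by have := inH2 1 0 (mem0v _); rewrite scale1r addr0.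
pose phi2 : 'Hom(F, R^o) := (phi \o linfun (fst : F -> E))%VF.
have phi2E u : phi2 u = phi u.1 by rewrite comp_lfunE lfunE.
have phi2_ge0 u : u \in H2 -> K2 u -> 0 <= phi2 u.
  case/memv_addP => _ /vlineP[s ->] [_ /memv_imgP[w wW ->] ->].
  rewrite lfunE phi2E /= => -[/= Ku].
  rewrite /GRing.scale /= mulr1 addr0 => s0.
  have phia : 0 <= phi a.
    by have := phi_ge0 0 (mem0v _); rewrite addr0; apply.
  (* A vector of height [s] may have [s = 0]; adding [d *: a] makes the height
     positive, and rescaling to height one brings it back to [a + W]. *)
  apply: (ge0_of_ge0_add phia) => d d0.
  have sd : 0 < s + d by rewrite ltr_wpDl.
  have uE : s *: a + w + d *: a = (s + d) *: (a + (s + d)^-1 *: w).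
    by rewrite scalerDr scalerA divff ?gt_eqF // scale1r scalerDl addrAC.
  have -> : phi (s *: a + w) + d * phi a = phi (s *: a + w + d *: a).
    by rewrite [RHS]linearD linearZ.
  rewrite uE linearZ /=; apply: mulr_ge0; first exact: ltW.
  apply: phi_ge0; first by rewrite memvZ.
  have -> : a + (s + d)^-1 *: w = (s + d)^-1 *: (s *: a + w + d *: a).
    by rewrite uE scalerA mulVf ?gt_eqF // scale1r.
  by apply: (KZ); [rewrite invr_ge0 ltW|apply: KD => //; apply: KZ => //; rewrite ltW].
have [psi psiE psi_ge0] := riesz_extension coneK2 intK2 a1H phi2_ge0.
exists (psi \o linfun level0)%VF, (psi (0, 1)); split.
- by apply: psi_ge0; split => //=; have := KZ 0 _ (lexx _) Ka; rewrite scale0r.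
- by move=> Y KY; rewrite comp_lfunE lfunE /=; apply: psi_ge0; split => /=.
- move=> w wW; have := psiE _ (inH2 1 w wW); rewrite phi2E /= scale1r => <-.
  rewrite comp_lfunE lfunE /= -linearD; congr (psi _); congr pair.
    by rewrite addr0.
  by rewrite add0r.
Qed.

End AffineRiesz.

(** * Conic duality for powers of the semidefinite cone *)

Section PsdLift.
Variable R : realType.

(** A lower bound for the eigenvalues of the symmetric part of [S], in a form
that needs no spectral theorem. *)
Lemma gram_form_le r (S : 'M[R]_r) : exists2 c : R, 0 <= c &
  forall u : 'cV[R]_r, - (u^T *m S *m u) ord0 ord0 <= c * (u^T *m u) ord0 ord0.
Proof.
exists (\sum_a \sum_b `|S b a|).
  by apply: sumr_ge0 => a _; apply: sumr_ge0.
move=> u; rewrite norm2_row mxE -sumrN mulr_suml; apply: ler_sum => a _.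
rewrite mxE -mulNr -sumrN !mulr_suml; apply: ler_sum => b _.
rewrite mxE; set N := \sum_i _.
have sqN i : u i ord0 ^+ 2 <= N.
  rewrite /N (bigD1 i) //= lerDl; apply: sumr_ge0 => k _; exact: sqr_ge0.
have := sqN a; have := sqN b; move: (u a ord0) (u b ord0) (S b a) => x y s ha hb.
have h1 : x * y <= N by nra.
have h2 : - (x * y) <= N by nra.
by have [h|h] := ler0P s; nra.
Qed.

(** [P] plays the role of the projection onto the range of [A].  On that range
[A] is definite, hence the compression of [A] to it stays positive semidefinite
under small perturbations [s *: Y], at least when [s * c <= 1]. *)
Lemma range_projection j (A : 'M[R]_j) : A^T = A -> psd A ->
  exists P : 'M[R]_j,
    (forall B : 'M[R]_j, (B <= A)%MS -> B *m P = B) /\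
    forall Y : 'M[R]_j, exists2 c : R, 0 <= c &
      forall s, 0 <= s -> s * c <= 1 -> psd (P^T *m (A + s *: Y) *m P).
Proof.
move=> symA psdA; have [r [G GE]] := psd_gram symA psdA.
(* Any generalized inverse of [G] does: only [G *m P = G] matters. *)
exists (pinvmx G *m G); split=> [B BA|Y].
  by rewrite mulmxA mulmxKpV // (submx_trans BA) // GE submxMl.
have GQG : G *m pinvmx G *m G = G by rewrite mulmxKpV.
set Q := pinvmx G in GQG *.
have PAP : (Q *m G)^T *m A *m (Q *m G) = G^T *m G.
  transitivity ((G *m Q *m G)^T *m (G *m Q *m G)); last by rewrite GQG.
  by rewrite GE !trmx_mul !mulmxA.
have [c c0 Hc] := gram_form_le (Q^T *m Y *m Q).
exists c => // s s0 sc v; pose u := G *m v.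
have -> : v^T *m ((Q *m G)^T *m (A + s *: Y) *m (Q *m G)) *m v =
    u^T *m u + s *: (u^T *m (Q^T *m Y *m Q) *m u).
  rewrite mulmxDr mulmxDl mulmxDr mulmxDl -scalemxAr -scalemxAl -scalemxAr.
  rewrite -scalemxAl PAP /u !trmx_mul; congr (_ + _ *: _); by rewrite !mulmxA.
rewrite mxE [X in _ + X]mxE.
have := Hc u; have : 0 <= (u^T *m u) ord0 ord0.
  by rewrite norm2_row; apply: sumr_ge0 => i _; apply: sqr_ge0.
move: ((u^T *m u) ord0 ord0) ((u^T *m _ *m u) ord0 ord0) => x y x0 hy.
have : s * (- y) <= s * (c * x) by rewrite ler_wpM2l.
have : (s * c) * x <= 1 * x by rewrite ler_wpM2r.
lra.
Qed.

Variables (j m : nat).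

Let E : vectType R := {ffun 'I_m -> subvs_of (sym_mx R j)}.

Lemma sym_mxP (A : 'M[R]_j) : reflect (A^T = A) (A \in sym_mx R j).
Proof.
by apply: (iffP fixedSpaceP); rewrite lfunE.
Qed.

Lemma sym_block (Y : E) i : (vsval (Y i))^T = vsval (Y i).
Proof. by apply/sym_mxP/subvsP. Qed.

Lemma blockD (A B : E) i :
  vsval ((A + B) i) = (vsval (A i) + vsval (B i))%R :> 'M[R]_j.
Proof. by rewrite ffunE linearD. Qed.

Lemma blockZ c (A : E) i : vsval ((c *: A) i) = c *: vsval (A i) :> 'M[R]_j.
Proof. by rewrite ffunE linearZ. Qed.

Lemma psd_cone_power_convex : convex_cone (@psd_cone_power R j m).
Proof.
split=> [A B KA KB i v|c A c0 KA i v].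
  rewrite blockD mulmxDr mulmxDl mxE addr_ge0 //; [exact: KA|exact: KB].
by rewrite blockZ -scalemxAr -scalemxAl mxE mulr_ge0 //; exact: KA.
Qed.

(** A point of the relative interior of the feasible set, for the purposes of
ranges: take a feasible tuple of maximal total rank.  By [psd_add_submx] its
midpoint with another feasible tuple has a range that contains both ranges, and
maximality forces equality. *)
Lemma generic_point (H : set E) : affine_subspace H ->
  (@psd_cone_power R j m `&` H) !=set0 ->
  exists A0, (@psd_cone_power R j m `&` H) A0 /\
    forall A, (@psd_cone_power R j m `&` H) A ->
      forall i, (vsval (A i) <= vsval (A0 i))%MS.
Proof.
move=> [a [W HE]] [A1 A1H].
pose rk (A : E) := (\sum_i \rank (vsval (A i)))%N.
pose P n := `[< exists2 A, (@psd_cone_power R j m `&` H) A & rk A = n >].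
have exP : exists n, P n by exists (rk A1); apply/asboolP; exists A1.
have ubP n : P n -> (n <= m * j)%N.
  move=> /asboolP[A _ <-]; rewrite -[m in (_ <= m * _)%N]card_ord -sum_nat_const.
  by apply: leq_sum => i _; apply: rank_leq_row.
have [_ /asboolP[A0 A0H <-] maxA0] := ex_maxnP exP ubP.
exists A0; split=> // A [KA HA] i; have [KA0 HA0] := A0H.
have [KD KZ] := psd_cone_power_convex.
pose M : E := 2^-1 *: (A + A0).
have KM : psd_cone_power M by apply: KZ; [rewrite invr_ge0|apply: KD].
have HM : H M.
  move: HA HA0; rewrite HE => -[w wW wE] [w0 w0W w0E].
  exists (2^-1 *: (w + w0)); first by apply: memvZ; apply: memvD.
  have {1}-> : a = 2^-1 *: (a + a).
    by rewrite -mulr2n -(scaler_nat 2 a) scalerA mulVf ?pnatr_eq0 // scale1r.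
  by rewrite /M -wE -w0E -scalerDr addrACA.
have ME l : vsval (M l) = 2^-1 *: (vsval (A l) + vsval (A0 l)).
  by rewrite blockZ blockD.
have h2 : (2^-1 : R) != 0 by rewrite invr_eq0 pnatr_eq0.
have A_M l : (vsval (A l) <= vsval (M l))%MS.
  rewrite ME (eqmx_scale _ h2).
  by apply: psd_add_submx; rewrite ?sym_block //; [apply: KA|apply: KA0].
have A0_M l : (vsval (A0 l) <= vsval (M l))%MS.
  rewrite ME (eqmx_scale _ h2) [_ + _]addrC.
  by apply: psd_add_submx; rewrite ?sym_block //; [apply: KA0|apply: KA].
have rkM : (rk M <= rk A0)%N by apply: maxA0; apply/asboolP; exists M.
apply: submx_trans (A_M i) _; rewrite -(mxrank_leqif_sup (A0_M i)).
rewrite eqn_leq mxrankS //= leqNgt; apply/negP => lt.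
move: rkM; rewrite leqNgt => /negP[]; rewrite /rk (bigD1 i) // [X in (_ < X)%N](bigD1 i) //=.
by rewrite -addSn leq_add //; apply: leq_sum => l _; apply: mxrankS.
Qed.

(** Conic duality without a constraint qualification.  A functional that is
nonnegative on the feasible set agrees there with a functional that is
nonnegative on the whole cone, up to a nonnegative constant.  The theorem of
M. Riesz is applied to the cone [K] of tuples that are positive semidefinite on
the ranges of the generic point [A0], and to those directions of [H] that stay
within these ranges. *)
Lemma dual_certificate (H : set E) (phi : 'Hom(E, R^o)) : affine_subspace H ->
  (@psd_cone_power R j m `&` H) !=set0 ->
  (forall A, (@psd_cone_power R j m `&` H) A -> 0 <= phi A) ->
  exists (B : 'Hom(E, R^o)) (c : R),
    [/\ 0 <= c, (forall A, psd_cone_power A -> 0 <= B A) &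
        forall A, (@psd_cone_power R j m `&` H) A -> phi A = B A + c].
Proof.
move=> affH KH0 phi_ge0; have [A0 [[KA0 HA0] maxA0]] := generic_point affH KH0.
have /choice[P HP] : forall i, exists P : 'M[R]_j,
    (forall B : 'M[R]_j, (B <= vsval (A0 i))%MS -> B *m P = B) /\
    forall Y : 'M[R]_j, exists2 c : R, 0 <= c &
      forall s, 0 <= s -> s * c <= 1 ->
      psd (P^T *m (vsval (A0 i) + s *: Y) *m P).
  by move=> i; apply: range_projection; [exact: sym_block | exact: KA0].
pose K : set E := [set Y | forall i, psd ((P i)^T *m vsval (Y i) *m P i)].
have coneK : convex_cone K.
  split=> [A B KA KB i v|c A c0 KA i v].
    rewrite blockD mulmxDr !mulmxDl mulmxDr mulmxDl mxE.
    by rewrite addr_ge0 //; [exact: KA|exact: KB].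
  rewrite blockZ -scalemxAr -!scalemxAl -scalemxAr -scalemxAl mxE.
  by rewrite mulr_ge0 //; exact: KA.
have intK : algebraic_interior K A0.
  move=> Y; have /choice[c Hc] : forall i, exists c : R, 0 <= c /\
      forall s, 0 <= s -> s * c <= 1 ->
      psd ((P i)^T *m (vsval (A0 i) + s *: vsval (Y i)) *m P i).
    by move=> i; have [c c0 h] := (HP i).2 (vsval (Y i)); exists c.
  have sc0 : 0 < 1 + \sum_i c i.
    by rewrite ltr_pwDl // sumr_ge0 // => i _; case: (Hc i).
  exists (1 + \sum_i c i)^-1; first by rewrite invr_gt0.
  move=> i; rewrite blockD blockZ; apply: (Hc i).2.
    by rewrite invr_ge0 ltW.
  rewrite mulrC ler_pdivrMr // mul1r (bigD1 i) //= addrCA lerDl addr_ge0 //.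
  by rewrite sumr_ge0 // => l _; case: (Hc l).
(* The kernel of [defect] consists of the tuples with ranges within those of
   [A0]. *)
pose defect (Y : E) : {ffun 'I_m -> 'M[R]_j} :=
  [ffun i => vsval (Y i) *m (P i - 1%:M)].
have defect_lin : linear defect.
  move=> s Y Z; apply/ffunP => i; rewrite !ffunE linearP /=.
  by rewrite mulmxDl -scalemxAl.
pose HBdef := GRing.isLinear.Build R E {ffun 'I_m -> 'M[R]_j} _ _ defect_lin.
pose defectL : {linear E -> {ffun 'I_m -> 'M[R]_j}} := HB.pack defect HBdef.
have [a [W HE]] := affH.
pose W' := (W :&: lker (linfun defectL))%VS.
have defectP (Y : E) : reflect (forall i, vsval (Y i) *m P i = vsval (Y i))
    (Y \in lker (linfun defectL)).
  rewrite memv_ker lfunE /=; apply: (iffP eqP) => [/ffunP h i|h].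
    have := h i; rewrite !ffunE mulmxBr mulmx1 => /eqP.
    by rewrite subr_eq0 => /eqP.
  by apply/ffunP => i; rewrite !ffunE mulmxBr mulmx1 h subrr.
have fixA A : (@psd_cone_power R j m `&` H) A -> A \in lker (linfun defectL).
  by move=> KHA; apply/defectP => i; apply: (HP i).1; apply: maxA0.
have HA0W w : w \in W -> H (A0 + w).
  move: HA0; rewrite HE => -[w0 w0W <-] wW; exists (w0 + w); rewrite ?addrA //=.
  exact: memvD.
have subW A : H A -> A - A0 \in W.
  move: HA0; rewrite HE => -[w0 w0W <-] [w wW <-].
  by rewrite opprD addrACA subrr add0r; apply: memvB.
have [|B [c [c0 B_ge0 phiE]]] := @affine_riesz_extension _ _ K A0 W' phi coneK intK.
  move=> w /memv_capP[wW wD] Kw; apply: phi_ge0; split; last exact: HA0W.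
  have /defectP fixw : A0 + w \in lker (linfun defectL).
    by rewrite memvD // fixA.
  move=> i; have := Kw i; rewrite -mulmxA fixw -[in X in psd X](sym_block (A0 + w) i).
  by rewrite -trmx_mul fixw sym_block.
exists B, c; split=> // [A KA|A KHA].
  apply: B_ge0 => i v; have := KA i (P i *m v).
  by rewrite trmx_mul !mulmxA.
have := phiE (A - A0); rewrite [A0 + _]addrC subrK; apply.
rewrite memv_cap subW; last by case: KHA.
by rewrite memvB // fixA.
Qed.

End PsdLift.

(** * Vanishing patterns force large blocks *)

Section Separation.
Variables (R : realType) (j m : nat) (T : eqType).

(** For a block [i], [V i] is the current ambient subspace and [N x i] the zero
space of the form attached to [x].  Every [x] outside a small [W] is told apart
from [W] by a vector in some block. *)
Definition separated (k : nat) (V : 'I_m -> 'M[R]_j) (N : T -> 'I_m -> 'M[R]_j)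
    (s : seq T) : Prop :=
  forall (x : T) (W : seq T),
    x \in s -> {subset W <= s} -> (size W <= k)%N -> x \notin W ->
  exists (i : 'I_m) (v : 'rV[R]_j),
    [/\ (v <= V i)%MS, {in W, forall y, (v <= N y i)%MS} & ~~ (v <= N x i)%MS].

Fixpoint separation_bound (k : nat) : nat :=
  if k is k'.+1 then (2 ^ m * (separation_bound k').+1)%N else 0%N.

Lemma pigeonhole (C : finType) (c0 : C) (col : T -> C) (s : seq T) :
  exists c, (size s <= #|C| * count (fun x => col x == c) s)%N.
Proof.
pose cnt c := count (fun x => col x == c) s.
have -> : size s = (\sum_c cnt c)%N.
  under eq_bigr => c _ do rewrite /cnt -sum1_count.
  rewrite (exchange_big_dep predT) //= -sum1_size; apply: eq_bigr => x _.
  by rewrite (eq_bigl (pred1 (col x))) ?big_pred1_eq // => c; rewrite /= eq_sym.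
case: (@arg_maxnP _ c0 predT cnt isT) => c _ cmax; exists c.
by rewrite -sum_nat_const; apply: leq_sum => c' _; apply: cmax.
Qed.

(** Induction on [k].  By the pigeonhole principle many points have the same
set [c] of blocks on which their form vanishes identically.  No block of [c]
can separate such points, so it is replaced by zero; in the other blocks,
intersecting with the zero space of one such point [x0] lowers the dimension.
Putting [x0] into every [W] shows that the remaining points are separated for
[k - 1]. *)
Lemma separated_size k V N s : (forall i, (\rank (V i) <= k)%N) -> uniq s ->
  separated k V N s -> (size s <= separation_bound k)%N.
Proof.
elim: k V s => [|k IH] V s rkV us sepV.
  case: s us sepV => // x s _ /(_ x [::] (mem_head _ _)) [] // i [v [vV _ /negP[]]].
  have /eqP V0 : V i == 0 by rewrite -mxrank_eq0 -leqn0.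
  by move: vV; rewrite V0 submx0 => /eqP ->; apply: sub0mx.
pose col x := [set i | (V i <= N x i)%MS]%SET.
have [c] := pigeonhole finset.set0 col s.
rewrite -cardsT -powersetT card_powerset cardsT card_ord -size_filter.
move=> /leq_trans; apply; rewrite leq_mul2l; apply/orP; right.
have : uniq [seq x <- s | col x == c] by rewrite filter_uniq.
have : forall x, x \in [seq x <- s | col x == c] -> x \in s /\ col x = c.
  by move=> x; rewrite mem_filter => /andP[/eqP ? ?].
case: [seq x <- s | col x == c] => // x0 s' s'P /andP[x0s' us'] /=.
have [x0s x0c] := s'P x0 (mem_head _ _).
pose V' i := if i \in c then 0 else (V i :&: N x0 i)%MS.
rewrite ltnS; apply: (IH V') => // [i|x W xs' Ws' szW xW].
  rewrite /V'; case: ifP => [_|/negbT ic]; first by rewrite mxrank0.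
  rewrite -ltnS (leq_trans _ (rkV i)) //.
  have := mxrank_leqif_sup (capmxSl (V i) (N x0 i)); move/ltn_leqif => ->.
  by apply: contra ic; rewrite sub_capmx submx_refl -x0c inE.
have s's y : y \in s' -> y \in s /\ col y = c.
  by move=> ys'; apply: s'P; rewrite inE ys' orbT.
have [||i [v [vV vW vx]]] := sepV x (x0 :: W) (s's x xs').1 _ szW.
- by move=> y; rewrite inE => /predU1P[->//|/Ws'/s's[]].
- by rewrite inE negb_or xW andbT; apply: contraNneq x0s' => <-.
have ic : i \notin c.
  apply: contra vx; rewrite -(s's x xs').2 inE; exact: submx_trans.
exists i, v; split=> //.
  by rewrite /V' (negbTE ic) sub_capmx vV vW // mem_head.
by move=> y yW; apply: vW; rewrite inE yW orbT.
Qed.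

End Separation.

Section LowerBound.
Variables (R : realType) (j m : nat).

Let E : vectType R := {ffun 'I_m -> subvs_of (sym_mx R j)}.

Definition block (i : 'I_m) (X : 'M[R]_j) : E :=
  [ffun l => if l == i then vsproj (sym_mx R j) X else 0].

Lemma block_is_linear i : linear (block i).
Proof.
move=> c X Y; apply/ffunP => l; rewrite !ffunE.
by case: eqP => _; rewrite ?linearP // scaler0 addr0.
Qed.

HB.instance Definition _ i :=
  GRing.isLinear.Build R 'M[R]_j E _ (block i) (block_is_linear i).

Lemma sum_block (A : E) : A = \sum_i block i (vsval (A i)).
Proof.
apply/ffunP => l; rewrite sum_ffunE (bigD1 l) //= ffunE eqxx vsvalK.
rewrite big1 ?addr0 // => i; rewrite ffunE eq_sym => /negbTE ->.
by [].
Qed.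

Lemma block_rank1_psd i (v : 'rV[R]_j) : psd_cone_power (block i (v^T *m v)).
Proof.
move=> l u; rewrite ffunE; case: eqP => _.
  rewrite vsprojK; first exact: gram_psd.
  by apply/sym_mxP; rewrite trmx_mul trmxK.
by rewrite (linear0 vsval) mulmx0 mul0mx mxE.
Qed.

Lemma sum_rank1_blocks (A : E) : psd_cone_power A ->
  exists s : 'I_m -> seq 'rV[R]_j,
    A = \sum_i \sum_(g <- s i) block i (g^T *m g).
Proof.
move=> KA.
have /choice[s sE] : forall i, exists s : seq 'rV[R]_j,
    vsval (A i) = \sum_(g <- s) g^T *m g.
  move=> i; have [r [G ->]] := psd_gram (sym_block A i) (KA i).
  exists [seq row a G | a <- enum 'I_r].
  by rewrite big_map big_enum sum_gram_rows.
exists s; rewrite {1}[A]sum_block; apply: eq_bigr => i _.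
by rewrite sE linear_sum.
Qed.

(** The form [v |-> B (block i (v^T *m v))] is positive semidefinite, so it is
the squared norm of a linear map by [psd_gram]; its zeros are the kernel of
that map. *)
Lemma form_kernel (B : 'Hom(E, R^o)) i :
  (forall A, psd_cone_power A -> 0 <= B A) ->
  exists N : 'M[R]_j, forall v : 'rV[R]_j, (v <= N)%MS = (B (block i (v^T *m v)) == 0).
Proof.
move=> B_ge0; pose q (v : 'rV[R]_j) : R := B (block i (v^T *m v)).
pose M : 'M[R]_j := \matrix_(a, b) B (block i (delta_mx a b)).
have qE (v : 'rV[R]_j) : q v = (v *m M *m v^T) ord0 ord0.
  have -> : q v = B (block i (\sum_a \sum_b (v ord0 a * v ord0 b) *: delta_mx a b)).
    congr (B (block i _)); rewrite [LHS]matrix_sum_delta; apply: eq_bigr => a _.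
    by apply: eq_bigr => b _; rewrite !mxE big_ord1 !mxE.
  rewrite !linear_sum mxE.
  under [RHS]eq_bigr do rewrite !mxE mulr_suml.
  rewrite [RHS]exchange_big /=; apply: eq_bigr => a _.
  rewrite !linear_sum /=; apply: eq_bigr => b _.
  by rewrite !linearZ /= !mxE /GRing.scale /= mulrAC.
(* The form has the matrix [M], which need not be symmetric; [M + M^T] gives
   twice the form. *)
have symM : (M + M^T)^T = M + M^T by rewrite linearD /= trmxK addrC.
have MTE (v : 'rV[R]_j) : (v *m M^T *m v^T) ord0 ord0 = q v.
  have -> : v *m M^T *m v^T = (v *m M *m v^T)^T.
    by rewrite !trmx_mul trmxK mulmxA.
  by rewrite mxE -qE.
have twoq (v : 'rV[R]_j) : (v *m (M + M^T) *m v^T) ord0 ord0 = q v *+ 2.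
  by rewrite mulmxDr mulmxDl mxE MTE -qE.
have psdM : psd (M + M^T).
  move=> v; have := twoq v^T; rewrite trmxK => ->.
  by rewrite mulrn_wge0 // B_ge0 //; apply: block_rank1_psd.
have [r [G GE]] := psd_gram symM psdM.
exists (kermx G^T); move=> v; apply/sub_kermxP/eqP => [vG|qv].
  have := twoq v; rewrite GE mulmxA vG !mul0mx mxE => /esym/eqP.
  by rewrite mulrn_eq0 /= => /eqP.
have := twoq v; rewrite /q qv mul0rn GE.
have -> : v *m (G^T *m G) *m v^T = ((G *m v^T)^T)  *m (G *m v^T).
  by rewrite trmx_mul trmxK !mulmxA.
rewrite norm2_row => /psumr_eq0P h; apply/trmx_inj/matrixP => a b.
rewrite trmx_mul trmxK trmx0 [b]ord1 [RHS]mxE; apply/eqP; rewrite -sqrf_eq0.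
by apply/eqP; apply: h => // c _; apply: sqr_ge0.
Qed.

(** [B y A] is a sum of the values of [B y] at the rank one terms of [A].  For
[y] in [W] these are nonnegative with sum zero; for [x] one of them is not
zero. *)
Lemma vanishing_witness (T : eqType) (B : T -> 'Hom(E, R^o)) (A : E) x (W : seq T) :
  (forall y C, psd_cone_power C -> 0 <= B y C) -> psd_cone_power A ->
  B x A != 0 -> {in W, forall y, B y A = 0} ->
  exists i (v : 'rV[R]_j), B x (block i (v^T *m v)) != 0 /\
    {in W, forall y, B y (block i (v^T *m v)) = 0}.
Proof.
move=> B_ge0 KA BxA BWA; have [s AE] := sum_rank1_blocks KA.
have BE y : B y A = \sum_i \sum_(g <- s i) B y (block i (g^T *m g)).
  by rewrite {1}AE linear_sum; apply: eq_bigr => i _; rewrite linear_sum.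
have [i [g gs Bxg]] : exists i, exists2 g, g \in s i &
    B x (block i (g^T *m g)) != 0.
  apply: contrapT => no; move/eqP: BxA; apply; rewrite BE.
  apply: big1 => i _; apply: big1_seq => g /andP[_ gs].
  by apply: contrapT => /eqP h; apply: no; exists i, g.
exists i, g; split=> // y yW; move/eqP: (BWA y yW); rewrite BE.
have q0 l (h : 'rV[R]_j) : 0 <= B y (block l (h^T *m h)).
  by exact: (B_ge0 y _ (block_rank1_psd l h)).
rewrite psumr_eq0 => [/allP /(_ i)|l _]; last exact: sumr_ge0.
rewrite mem_index_enum /= psumr_eq0 // => /(_ isT) /allP /(_ g gs).
by move=> /eqP.
Qed.

(** The obstruction to small blocks.  The [ell x] are nonnegative functionals on
[S], and the elements of [S] realize all zero patterns of size at most [k] on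
the points of [s]; then [s] cannot be long. *)
Lemma lift_separation (V : lmodType R) (S : set V) (T : eqType)
    (ell : T -> {linear V -> R^o}) (k : nat) (s : seq T) :
  has_lift (@psd_cone_power R j m) S -> (0 < k)%N -> (j <= k)%N ->
  (forall x p, x \in s -> S p -> 0 <= ell x p) ->
  uniq s ->
  (forall x W, x \in s -> {subset W <= s} -> (size W <= k)%N -> x \notin W ->
    exists2 p, S p & ell x p != 0 /\ {in W, forall y, ell y p = 0}) ->
  (size s <= separation_bound m k)%N.
Proof.
move=> [H [f [affH SE]]] k0 jk ell_ge0 us sepS.
rewrite leqNgt; apply/negP => lt.
have s2 : (1 < size s)%N.
  case: (k) k0 lt => // k' _; apply: leq_ltn_trans => /=.
  by rewrite muln_gt0 expn_gt0.
pose phi x : 'Hom(E, R^o) := linfun (ell x \o f).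
have phiE x A : phi x A = ell x (f A) by rewrite lfunE.
have KHS A : (@psd_cone_power R j m `&` H) A -> S (f A).
  by move=> KHA; rewrite SE; exists A.
have other x : x \in s -> exists2 y, y \in s & y != x.
  case: s us s2 {sepS lt ell_ge0} => [|a [|b s]] //= /andP[ab _] _ xs.
  have [->|ax] := eqVneq x a.
    exists b; rewrite ?inE ?eqxx ?orbT //; apply: contra ab => /eqP <-.
    exact: mem_head.
  by exists a; rewrite ?mem_head // eq_sym.
have vanish x : x \in s -> exists2 A, (@psd_cone_power R j m `&` H) A &
    phi x A = 0.
  move=> xs; have [y ys yx] := other x xs.
  have [||||p Sp [_ p0]] := sepS y [:: x] => //.
  - by move=> z; rewrite inE => /eqP ->.
  - by rewrite inE.
  move: Sp; rewrite SE => -[A KHA fA]; exists A => //.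
  by rewrite phiE fA p0 // mem_head.
(* The constant of the dual certificate is zero because [phi x] vanishes at a
   feasible tuple; this uses a pattern [W] that contains [x]. *)
have cert x : exists B : 'Hom(E, R^o),
    (forall A, psd_cone_power A -> 0 <= B A) /\
    (x \in s -> forall A, (@psd_cone_power R j m `&` H) A -> phi x A = B A).
  have [xs|_] := boolP (x \in s); last first.
    by exists 0; split=> // A _; rewrite lfunE.
  have [A0 KHA0 A00] := vanish x xs.
  have [||B [c [c0 B_ge0 BE]]] := @dual_certificate _ _ _ H (phi x) affH.
  - by exists A0.
  - by move=> A KHA; rewrite phiE; apply: ell_ge0 => //; apply: KHS.
  exists B; split=> // _ A KHA; rewrite BE //.
  have := BE _ KHA0; rewrite A00 => /esym/eqP.
  rewrite paddr_eq0 //; first by move=> /andP[_ /eqP ->]; rewrite addr0.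
  by apply: B_ge0; case: KHA0.
have /choice[B HB] := cert.
have B_ge0 x A : psd_cone_power A -> 0 <= B x A by apply: (HB x).1.
have /choice[N HN] : forall xi : T * 'I_m, exists N : 'M[R]_j,
    forall v : 'rV[R]_j, (v <= N)%MS = (B xi.1 (block xi.2 (v^T *m v)) == 0).
  by move=> [x i]; apply: form_kernel; apply: B_ge0.
move: lt; apply/negP; rewrite -leqNgt.
apply: (@separated_size R j m T k (fun=> 1%:M) (fun x i => N (x, i))) => //.
  by move=> i; rewrite mxrank1.
move=> x W xs Ws szW xW; have [p Sp [px pW]] := sepS x W xs Ws szW xW.
move: Sp; rewrite SE => -[A KHA fA]; have [KA _] := KHA.
have [||i [v [vx vW]]] := @vanishing_witness T B A x W B_ge0 KA.
- by rewrite -(HB x).2 // phiE fA.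
- by move=> y yW; rewrite -(HB y).2 ?Ws // phiE fA pW.
exists i, v; split; first exact: submx1.
  by move=> y yW; rewrite HN /= vW.
by rewrite HN /=.
Qed.

End LowerBound.

(** * Points in general position *)

(** A monomial of degree at most [d] is the tuple of its exponents. *)
Lemma card_bounded_monomials (n d : nat) :
  #|{: 'X_{1..n < d.+1}}| = 'C(n + d, n).
Proof.
rewrite -card_partial_ord_partitions.
pose f (m : 'X_{1..n < d.+1}) : n.-tuple 'I_d.+1 := [tuple inord (m i) | i < n].
have fE m i : tnth (f m) i = m i :> nat.
  rewrite tnth_mktuple inordK //; apply: leq_ltn_trans (bmdeg m).
  by rewrite mdegE (bigD1 i) //= leq_addr.
have f_inj : injective f.
  move=> m1 m2 fm; apply/val_inj/mnmP => i.
  by have := congr1 (fun t => val (tnth t i)) fm; rewrite /= !fE.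
rewrite -(card_imset _ f_inj); apply: eq_card => t; rewrite inE.
apply/imsetP/idP => [[m _ ->]|ht].
  rewrite big_tuple; under eq_bigr do rewrite fE.
  by rewrite -mdegE -ltnS bmdeg.
pose m : 'X_{1..n} := [multinom (tnth t i : nat) | i < n].
have md : (mdeg m < d.+1)%N.
  rewrite ltnS mdegE; move: ht; rewrite big_tuple.
  suff -> : (\sum_i m i = \sum_i tnth t i)%N by [].
  by apply: eq_bigr => i _; rewrite mnmE.
exists (BMultinom md) => //; apply: eq_from_tnth => i.
by apply: val_inj; rewrite /= [RHS]fE /= mnmE.
Qed.

Lemma digits_inj (D n : nat) (a b : 'I_n -> nat) :
  (forall i, a i < D)%N -> (forall i, b i < D)%N ->
  (\sum_i a i * D ^ i = \sum_i b i * D ^ i)%N -> a =1 b.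
Proof.
elim: n a b => [|n IH] a b aD bD; first by move=> _ [].
rewrite !big_ord_recl !muln1.
have shift (c : 'I_n.+1 -> nat) :
    (\sum_(i < n) c (lift ord0 i) * D ^ (lift ord0 i))%N
    = ((\sum_(i < n) c (lift ord0 i) * D ^ i) * D)%N.
  by rewrite big_distrl; apply: eq_bigr => i _; rewrite /= /bump expnSr mulnA.
rewrite !shift ![(_ + _ * D)%N]addnC => E.
have D0 : (0 < D)%N by apply: leq_trans (aD ord0).
have a0 : a ord0 = b ord0.
  by have := congr1 (modn^~ D) E; rewrite !modnMDl !modn_small.
have S0 : a \o lift ord0 =1 b \o lift ord0.
  apply: IH => [i|i|] /=; [exact: aD|exact: bD|].
  by have := congr1 (divn^~ D) E; rewrite !divnMDl // !divn_small // !addn0.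
by move=> i; case: (unliftP ord0 i) => [l|] ->; [apply: S0|].
Qed.

Lemma seq_argmax (T : eqType) (disp : Order.disp_t) (U : orderType disp)
    (w : T -> U) (s : seq T) :
  s != [::] -> exists2 x, x \in s & forall y, y \in s -> (w y <= w x)%O.
Proof.
elim: s => // x [|x' s] IH _.
  by exists x; rewrite ?mem_head // => y; rewrite inE => /eqP ->.
have [x1 x1s H] := IH isT; case: (leP (w x) (w x1)) => h.
  exists x1; first by rewrite inE x1s orbT.
  by move=> y; rewrite inE => /predU1P[->//|/H].
exists x; first exact: mem_head.
move=> y; rewrite inE => /predU1P[->//|/H h1].
exact: le_trans h1 (ltW h).
Qed.

Section GeneralPosition.
Variables (R : realType) (n : nat).
Local Notation point := 'rV[R]_n.
Local Notation ev p x := (p.@[fun l => (x : point) ord0 l]).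

(** Kronecker substitution turns [p] into a nonzero polynomial in one variable:
put [z l + t ^+ (D ^ l)] for the variable [l], with [D] larger than all exponents.
Distinct monomials of [p] then get distinct degrees in [t] by [digits_inj], so
the highest degree does not cancel.  Some small [t] is not a root. *)
Lemma nonvanishing_near (p : {mpoly R[n]}) (z : point) (eps : R) :
  p != 0 -> 0 < eps ->
  exists2 y : point, (forall l, `|y ord0 l - z ord0 l| < eps) & ev p y != 0.
Proof.
move=> p0 eps0; pose D := msize p.
pose X (l : 'I_n) : {poly R} := 'X^(D ^ l) + (z ord0 l)%:P.
pose w (m : 'X_{1..n}) : nat := (\sum_l m l * D ^ l)%N.
have D0 : (0 < D)%N by rewrite lt0n msize_poly_eq0.
have XM l k : (X l ^+ k \is monic) && (size (X l ^+ k) == (k * D ^ l).+1)%N.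
  have mX : X l \is monic by rewrite monicXnaddC // expn_gt0 D0.
  rewrite monic_exp //= -[X in X == _]prednK; last first.
    by rewrite lt0n size_poly_eq0 expf_neq0 // monic_neq0.
  by rewrite size_exp size_XnaddC ?expn_gt0 ?D0 // mulnC.
have XmM m : (mmap1 X m \is monic) && (size (mmap1 X m) == (w m).+1).
  rewrite /mmap1 /w; elim/big_rec2: _ => [|l q e _ /andP[mq /eqP sq]].
    by rewrite monic1 size_poly1.
  have /andP[mX /eqP sX] := XM l (m l).
  rewrite monicMl // mq /= size_monicM ?monic_neq0 // sX sq.
  by rewrite addSn addnS.
pose P := mmap polyC X p.
have PE t : P.[t] = p.@[fun l => t ^+ (D ^ l) + z ord0 l].
  rewrite /P /mmap horner_sum mevalE; apply: eq_bigr => m _.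
  rewrite hornerCM /mmap1 horner_prod; congr (_ * _); apply: eq_bigr => l _.
  by rewrite horner_exp hornerD hornerXn hornerC.
have P0 : P != 0.
  have [m0 m0p maxm0] : exists2 m0, m0 \in msupp p &
      forall m, m \in msupp p -> (w m <= w m0)%N.
    have : msupp p != [::] by rewrite msupp_eq0.
    exact: (seq_argmax (U := nat) w).
  suff : P`_(w m0) != 0 by apply: contraNneq => ->; rewrite coef0.
  rewrite /P /mmap coef_sum (bigD1_seq m0) ?msupp_uniq //= big_seq_cond big1.
    rewrite addr0 coefCM; have /andP[/monicP mm /eqP sm] := XmM m0.
    by move: mm; rewrite /lead_coef sm /= => ->; rewrite mulr1 -mcoeff_msupp.
  move=> m /andP[mp mm0]; rewrite coefCM nth_default ?mulr0 //.
  have /andP[_ /eqP ->] := XmM m; rewrite ltn_neqAle maxm0 // andbT.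
  apply: contra mm0 => /eqP wE; apply/eqP/mnmP; apply: (digits_inj _ _ wE) => i.
    by apply: leq_ltn_trans (msize_mdeg_lt mp); rewrite mdegE (bigD1 i) //= leq_addr.
  by apply: leq_ltn_trans (msize_mdeg_lt m0p); rewrite mdegE (bigD1 i) //= leq_addr.
(* The candidates for [t] are more numerous than the roots of [P]; below 1, the
   powers of [t] are at most [t]. *)
pose del := Num.min 1 eps; have del0 : 0 < del by rewrite lt_min ltr01.
pose c (k : nat) : R := del / k.+2%:R.
have c0 k : 0 < c k by rewrite divr_gt0 ?ltr0n.
have c1 k : c k < del.
  by rewrite ltr_pdivrMr ?ltr0n // ltr_pMr // ltr1n.
have [k Pk] : exists k, P.[c k] != 0.
  apply: contrapT => no.
  have := @max_poly_roots _ P [seq c k | k <- iota 0 (size P)] P0.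
  rewrite size_map size_iota ltnn => H; apply: notF; apply: H.
    apply/allP => _ /mapP[k _ ->]; apply: contraT => h.
    by case: no; exists k.
  rewrite map_inj_uniq ?iota_uniq // => k1 k2 /(mulfI (lt0r_neq0 del0)).
  by move/invr_inj/eqP; rewrite eqr_nat => /eqP [].
exists (\row_l (c k ^+ (D ^ l) + z ord0 l)); last first.
  move: Pk; rewrite PE; congr (_ != 0); apply: meval_eq => l.
  by rewrite mxE.
move=> l; rewrite mxE addrK ger0_norm ?exprn_ge0 ?(ltW (c0 k)) //.
have ck1 : c k < 1 by rewrite (lt_le_trans (c1 k)) // ge_min lexx.
have : c k ^+ (D ^ l) <= c k.
  have : (0 < D ^ l)%N by rewrite expn_gt0 D0.
  case: (D ^ l)%N => // e _; rewrite exprS ler_piMr ?(ltW (c0 k)) //.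
  by rewrite exprn_ile1 // ltW.
move=> /le_lt_trans; apply; rewrite (lt_le_trans (c1 k)) //.
by rewrite ge_min lexx orbT.
Qed.

(** There are more coefficients than linear conditions. *)
Lemma poly_through_points (d : nat) (W : seq point) :
  (size W < 'C(n + d, n))%N ->
  exists f : {mpoly R[n]}, [/\ (msize f <= d.+1)%N, f != 0 &
    {in W, forall y, ev f y = 0}].
Proof.
rewrite -card_bounded_monomials => szW.
pose N := #|{: 'X_{1..n < d.+1}}|; rewrite -/N in szW.
pose mon (a : 'I_N) : 'X_{1..n < d.+1} := enum_val a.
pose M : 'M[R]_(N, size W) :=
  \matrix_(a, b) ev ('X_[mon a] : {mpoly R[n]}) (nth 0 W b).
have kM : kermx M != 0.
  rewrite -mxrank_eq0 mxrank_ker -lt0n subn_gt0.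
  exact: leq_ltn_trans (rank_leq_col M) szW.
have [u /sub_kermxP uM u0] := rowV0Pn kM.
pose f : {mpoly R[n]} := \sum_a u ord0 a *: 'X_[mon a].
exists f; split.
- apply: leq_trans (msize_sum _ _ _) _; apply/bigmax_leqP => a _.
  have [->|ua] := eqVneq (u ord0 a) 0; first by rewrite scale0r msize0.
  by rewrite msizeZ // msizeX bmdeg.
- have /rV0Pn[a ua] := u0.
  apply: contraNneq ua => /(congr1 (mcoeff (mon a))); rewrite mcoeff0.
  rewrite /f raddf_sum /= (bigD1 a) //= mcoeffZ mcoeffX eqxx mulr1.
  rewrite big1 ?addr0 => [-> //|b ba]; rewrite mcoeffZ mcoeffX.
  rewrite (_ : _ == _ = false) ?mulr0 //; apply: contraNF ba => /eqP h.
  by apply/eqP/enum_val_inj/val_inj.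
- move=> y yW; have ltW : (index y W < size W)%N by rewrite index_mem.
  have /matrixP/(_ ord0 (Ordinal ltW)) := uM; rewrite !mxE => uM0.
  rewrite -[RHS]uM0 /f raddf_sum /=; apply: eq_bigr => a _.
  by rewrite mevalZ !mxE /= nth_index.
Qed.

Definition general_position (k d : nat) (s : seq point) : Prop :=
  forall x (W : seq point), x \in s -> {subset W <= s} -> (size W <= k)%N ->
    x \notin W ->
  exists f : {mpoly R[n]}, [/\ (msize f <= d.+1)%N, ev f x != 0 &
    {in W, forall y, ev f y = 0}].

(** The points are chosen one by one.  The new point [y] avoids the zeros of a
nonzero polynomial through each small set of earlier points.  If [y] belongs
to [W] and [x] does not, correct a polynomial that vanishes on [W] without [y]
but not at [x] by a multiple of one that vanishes on [x] and [W] without [y]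
but not at [y]. *)
Lemma general_position_near (d k N : nat) (z : point) (eps : R)
    (h : {mpoly R[n]}) :
  (0 < k < 'C(n + d, n))%N -> 0 < eps -> h != 0 ->
  exists s : seq point, [/\ size s = N, uniq s, general_position k d s &
    {in s, forall y : point,
      (forall l, `|y ord0 l - z ord0 l| < eps) /\ ev h y != 0}].
Proof.
move=> /andP[k0 kC] eps0 h0; elim: N => [|N [s [<- us gps nears]]].
  by exists [::]; split.
have /choice[F HF] : forall W : seq point, exists f : {mpoly R[n]},
    f != 0 /\ ((size W <= k)%N -> (msize f <= d.+1)%N /\
       {in W, forall y, ev f y = 0}).
  move=> W; case: (leqP (size W) k) => szW; last first.
    by exists 1; split=> //; apply: oner_neq0.
  have [f [fd f0 fW]] := poly_through_points (leq_ltn_trans szW kC).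
  by exists f.
pose L := h :: [seq F (mask (m : bitseq) s) | m : (size s).-tuple bool].
have L0 : \prod_(f <- L) f != 0.
  rewrite prodf_seq_neq0; apply/allP => f; rewrite inE => /predU1P[->//|].
  by move=> /mapP[m _ ->]; case: (HF (mask m s)).
have [y ynear] := nonvanishing_near z L0 eps0.
rewrite (big_morph (meval _) (mevalM _) (meval1 _)) prodf_seq_neq0.
move=> /allP Ly.
have yh : ev h y != 0 by apply: Ly; apply: mem_head.
have through W : {subset W <= s} -> (size W <= k)%N ->
    exists f : {mpoly R[n]}, [/\ (msize f <= d.+1)%N, ev f y != 0 &
      {in W, forall y', ev f y' = 0}].
  move=> Ws szW; pose W' := [seq x <- s | x \in W].
  have W'E : W' = mask [seq x \in W | x <- s] s by rewrite /W' filter_mask.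
  have szW' : (size W' <= k)%N.
    apply: leq_trans szW; apply: uniq_leq_size; first exact: filter_uniq.
    by move=> x; rewrite mem_filter => /andP[].
  have [F0 /(_ szW')[Fd FW]] := HF W'.
  exists (F W'); split=> //; last first.
    by move=> x xW; apply: FW; rewrite mem_filter xW Ws.
  have szm : size [seq x \in W | x <- s] == size s by rewrite size_map.
  apply: Ly; rewrite inE; apply/orP; right; rewrite W'E.
  by apply/mapP; exists (Tuple szm); rewrite ?mem_enum.
have ys : y \notin s.
  apply/negP => ys; have [|f [_ /eqP fy fW]] := through [:: y] _ k0.
    by move=> x; rewrite inE => /eqP ->.
  by apply: fy; apply: fW; apply: mem_head.
exists (y :: s); split=> //=; first by rewrite ys.
- move=> x W; rewrite inE => xs Ws szW xW.
  have Ws' x' : x' \in W -> x' != y -> x' \in s.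
    by move=> /Ws; rewrite inE => /predU1P[->|//]; rewrite eqxx.
  have [xy|xy] := eqVneq x y.
    rewrite xy; apply: through => // x' x'W; apply: Ws' => //.
    by apply: contraNneq xW => x'y; rewrite xy -x'y.
  have {}xs : x \in s by move: xs; rewrite (negbTE xy).
  have [yW|yW] := boolP (y \in W); last first.
    by apply: gps => // x' x'W; apply: Ws' => //; apply: contraNneq yW => <-.
  pose W' := [seq x' <- W | x' != y].
  have W's : {subset W' <= s}.
    by move=> x'; rewrite mem_filter => /andP[x'y /Ws' ->].
  have szW' : (size W' < k)%N.
    apply: leq_trans szW; rewrite size_filter -(count_predC (pred1 y) W).
    by rewrite -add1n leq_add // -has_count has_pred1.
  have xW' : x \notin W' by rewrite mem_filter (negbTE xW) andbF.
  have [f [fd fx fW']] := gps x W' xs W's (ltnW szW') xW'.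
  have [|g [gd gy gW]] := through (x :: W') _ szW'.
    by move=> x'; rewrite inE => /predU1P[->//|/W's].
  have evE x' : ev (f - (ev f y / ev g y) *: g) x' =
      ev f x' - ev f y / ev g y * ev g x' by rewrite mevalB mevalZ.
  exists (f - (ev f y / ev g y) *: g); split.
  + rewrite (leq_trans (msizeD_le _ _)) // geq_max fd msizeN /=.
    have [->|c0] := eqVneq (ev f y / ev g y) 0; last by rewrite msizeZ.
    by rewrite scale0r msize0.
  + by rewrite evE (gW x (mem_head _ _)) mulr0 subr0.
  + move=> x' x'W; rewrite evE; have [->|x'y] := eqVneq x' y.
      by rewrite divfK // subrr.
    have x'W' : x' \in W' by rewrite mem_filter x'y.
    by rewrite fW' // (gW x') ?inE ?x'W' ?orbT // mulr0 subr0.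
- by move=> x; rewrite inE => /predU1P[->|/nears].
Qed.

End GeneralPosition.

(** * The truncated quadratic module *)

Section SumsOfSquares.
Variables (R : realType) (n : nat).

Lemma msize_sqr_le (q : {mpoly R[n]}) (d : nat) :
  (msize q <= d.+1)%N -> (msize (q ^+ 2) <= (2 * d).+1)%N.
Proof.
have [->|q0] := eqVneq q 0; first by rewrite expr0n msize0.
rewrite expr2 msizeM //; case: (msize q) => // a ad.
by rewrite addSn addnS /= mulSn mul1n ltnS leq_add.
Qed.

(** If [M] is the largest leading monomial of the squared polynomials, then the
coefficient of [M + M] in the sum is a nonzero sum of squares.  Hence [M], and
with it all squared polynomials, have degree at most [d]. *)
Lemma SigmaP (p : {mpoly R[n]}) (d : nat) : Sigma (2 * d) p <->
  exists s : seq {mpoly R[n]},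
    {in s, forall q, (msize q <= d.+1)%N} /\ p = \sum_(q <- s) q ^+ 2.
Proof.
split=> [[[s pE] pd]|[s [sd pE]]]; last first.
  split; first by exists s.
  rewrite pE big_seq (leq_trans (msize_sum _ _ _)) //.
  rewrite -big_seq; elim: s sd {pE} => [|q s IH] sd; first by rewrite big_nil.
  rewrite big_cons geq_max msize_sqr_le ?sd ?mem_head //=.
  by apply: IH => r rs; apply: sd; rewrite inE rs orbT.
exists s; split=> // q qs; have [->|q0] := eqVneq q 0; first by rewrite msize0.
have [q1 [q1s q10] maxq1] : exists2 q1, q1 \in s /\ q1 != 0 &
    forall q, q \in s -> (mlead q <= mlead q1)%O.
  have : [seq r <- s | r != 0] != [::].
    by rewrite -has_filter; apply/hasP; exists q.
  move=> /(seq_argmax (fun r : {mpoly R[n]} => mlead r))[q1].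
  rewrite mem_filter => /andP[q10 q1s] H; exists q1 => // r rs.
  have [->|r0] := eqVneq r 0; first by rewrite mlead0 le0m.
  by apply: H; rewrite mem_filter r0.
set M := mlead q1.
have pM : p@_(M + M)%MM != 0.
  rewrite pE raddf_sum /=.
  have sqE r : r \in s -> (r ^+ 2)@_(M + M)%MM = r@_M ^+ 2.
    by move=> rs; rewrite expr2 mleadcMW ?maxq1 // -expr2.
  rewrite (eq_big_seq _ sqE) psumr_neq0 => [|r _]; last exact: sqr_ge0.
  by apply/hasP; exists q1 => //; rewrite /= lt_def sqr_ge0 sqrf_eq0 mleadc_eq0 q10.
have : (mdeg (M + M)%MM < (2 * d).+1)%N.
  by apply: leq_trans pd; apply: msize_mdeg_lt; rewrite mcoeff_msupp.
rewrite mdegD -mlead_deg // => h.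
have := lemc_mdeg (maxq1 q qs); rewrite -/M => h'; lia.
Qed.

Lemma mem_mink_sum (V : zmodType) k (A : 'I_k -> set V) (x : V) :
  mink_sum A x <-> exists f : 'I_k -> V, (forall i, A i (f i)) /\ x = \sum_i f i.
Proof.
rewrite /mink_sum; elim: k A x => [|k IH] A x.
  rewrite big_ord0; split=> [->|[f [_ ->]]]; last by rewrite big_ord0.
  by exists (fun=> 0); split=> [[]//|]; rewrite big_ord0.
rewrite big_ord_recl; split=> [[a Aa [b /IH[f [Af ->]] <-]]|[f [Af ->]]].
  exists (fun i => if unlift ord0 i is Some l then f l else a); split.
    by move=> i; case: unliftP => [l|] ->.
  rewrite big_ord_recl unlift_none; congr (_ + _).
  by apply: eq_bigr => i _; rewrite liftK.
exists (f ord0) => //; exists (\sum_(i < k) f (lift ord0 i)).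
  by apply/IH; exists (fun i => f (lift ord0 i)).
by rewrite big_ord_recl.
Qed.

(** The index shift of [truncated_qmodule]: its summand of index [ord0] has the
multiplier 1. *)
Definition multiplier k (g : 'I_k -> {mpoly R[n]}) (i : 'I_k.+1) :
  {mpoly R[n]} := if unlift ord0 i is Some l then g l else 1.

Lemma truncated_qmoduleP k (g : 'I_k -> {mpoly R[n]}) d (p : {mpoly R[n]}) :
  truncated_qmodule g d p <-> exists s : 'I_k.+1 -> {mpoly R[n]},
    (forall i, Sigma (2 * d i) (s i)) /\ p = \sum_i multiplier g i * s i.
Proof.
split=> [[s0 Ss0 [q /mem_mink_sum[f [Hf ->]] <-]]|[s [Ss ->]]].
  have /choice[s Hs] : forall i, exists t, Sigma (2 * d (lift ord0 i)) t /\
      g i * t = f i by move=> i; have [t St E] := Hf i; exists t.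
  exists (fun i => if unlift ord0 i is Some l then s l else s0); split.
    by move=> i; case: unliftP => [l|] ->; [case: (Hs l)|].
  rewrite big_ord_recl /multiplier unlift_none mul1r; congr (_ + _).
  by apply: eq_bigr => i _; rewrite liftK (Hs i).2.
exists (s ord0); first exact: Ss.
exists (\sum_(i < k) g i * s (lift ord0 i)).
  apply/mem_mink_sum; exists (fun i => g i * s (lift ord0 i)); split=> // i.
  by exists (s (lift ord0 i)).
rewrite big_ord_recl /multiplier unlift_none mul1r; congr (_ + _).
by apply: eq_bigr => i _; rewrite liftK.
Qed.

End SumsOfSquares.

Section UpperBound.
Variables (R : realType) (n dm : nat).
Local Notation N := #|{: 'X_{1..n < dm.+1}}|.

Let mon (a : 'I_N) : 'X_{1..n < dm.+1} := enum_val a.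
Let low (d : nat) (a : 'I_N) : bool := (mdeg (mon a) <= d)%N.

Definition poly_of_row (d : nat) (v : 'rV[R]_N) : {mpoly R[n]} :=
  \sum_(a | low d a) v ord0 a *: 'X_[mon a].

(** The rows and columns of [X] that belong to monomials of degree larger than
[d] are ignored, which lets all blocks have the same size. *)
Definition gram_poly (d : nat) (X : 'M[R]_N) : {mpoly R[n]} :=
  \sum_(a | low d a) \sum_(b | low d b) X a b *: ('X_[mon a] * 'X_[mon b]).

Lemma gram_poly_is_linear d : linear (gram_poly d).
Proof.
move=> c X Y; rewrite /gram_poly scaler_sumr -big_split; apply: eq_bigr => a _.
rewrite scaler_sumr -big_split; apply: eq_bigr => b _.
by rewrite !mxE scalerDl scalerA.
Qed.

HB.instance Definition _ d :=
  GRing.isLinear.Build R 'M[R]_N {mpoly R[n]} _ (gram_poly d)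
    (gram_poly_is_linear d).

Lemma gram_poly_rank1 d (v : 'rV[R]_N) :
  gram_poly d (v^T *m v) = poly_of_row d v ^+ 2.
Proof.
rewrite expr2 /poly_of_row mulr_suml; apply: eq_bigr => a _.
rewrite mulr_sumr; apply: eq_bigr => b _.
by rewrite -scalerAl -scalerAr scalerA !mxE big_ord1 !mxE.
Qed.

Lemma msize_poly_of_row d v : (msize (poly_of_row d v) <= d.+1)%N.
Proof.
apply: leq_trans (msize_sum _ _ _) _; apply/bigmax_leqP => a la.
have [->|va] := eqVneq (v ord0 a) 0; first by rewrite scale0r msize0.
by rewrite msizeZ // msizeX.
Qed.

Lemma poly_of_rowK d (q : {mpoly R[n]}) : (d <= dm)%N -> (msize q <= d.+1)%N ->
  poly_of_row d (\row_a q@_(mon a)) = q.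
Proof.
move=> ddm qd; have qdm : (msize q <= dm.+1)%N by apply: leq_trans qd _.
rewrite [RHS](mpolywE qdm) (reindex_onto enum_val enum_rank) => [|m _]; last first.
  exact: enum_rankK.
rewrite /poly_of_row big_mkcond /=.
rewrite [RHS](eq_bigl predT) => [|a]; last by rewrite enum_valK eqxx.
apply: eq_bigr => a _; rewrite mxE; case: ifPn => // la.
rewrite memN_msupp_eq0 ?scale0r //; apply: contra la => /msize_mdeg_lt h.
by rewrite /low -ltnS (leq_trans h).
Qed.

Variables (k : nat) (g : 'I_k -> {mpoly R[n]}) (d : 'I_k.+1 -> nat).

Definition gram_lift (A : {ffun 'I_k.+1 -> subvs_of (sym_mx R N)}) :
  {mpoly R[n]} := \sum_i multiplier g i * gram_poly (d i) (vsval (A i)).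

Lemma gram_lift_is_linear : linear gram_lift.
Proof.
move=> c A B; rewrite /gram_lift scaler_sumr -big_split; apply: eq_bigr => i _.
by rewrite !ffunE !linearP /= mulrDr scalerAr.
Qed.

HB.instance Definition _ :=
  GRing.isLinear.Build R {ffun 'I_k.+1 -> subvs_of (sym_mx R N)} {mpoly R[n]} _
    gram_lift gram_lift_is_linear.

(** Sums of squares correspond to Gram matrices by [gram_poly_rank1], in both
directions. *)
Lemma truncated_qmodule_lift : (forall i, d i <= dm)%N ->
  has_psd_lift (truncated_qmodule g d) N.
Proof.
move=> ddm; exists k.+1 => //; exists setT, gram_lift; split.
  exists 0, fullv; apply/seteqP; split=> // A _.
  by exists A; rewrite /= ?memvf ?add0r.
apply/seteqP; split=> [p /truncated_qmoduleP[s [Ss ->]]|_ [A [KA _] <-]].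
  have /choice[sq Hsq] : forall i, exists sq : seq {mpoly R[n]},
      {in sq, forall q, (msize q <= (d i).+1)%N} /\ s i = \sum_(q <- sq) q ^+ 2.
    by move=> i; apply/SigmaP/Ss.
  pose row_of (q : {mpoly R[n]}) : 'rV[R]_N := \row_a q@_(mon a).
  pose G i : 'M[R]_N := \sum_(q <- sq i) (row_of q)^T *m row_of q.
  have GE i v : (v^T *m G i *m v) ord0 ord0 =
      \sum_(q <- sq i) (v^T *m ((row_of q)^T *m row_of q) *m v) ord0 ord0.
    by rewrite /G mulmx_sumr mulmx_suml summxE.
  have symG i : G i \in sym_mx R N.
    apply/sym_mxP; rewrite /G linear_sum; apply: eq_bigr => q _ /=.
    by rewrite trmx_mul trmxK.
  exists [ffun i => vsproj (sym_mx R N) (G i)].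
    split=> // i v; rewrite ffunE vsprojK // GE.
    by apply: sumr_ge0 => q _; apply: gram_psd.
  apply: eq_bigr => i _; rewrite ffunE vsprojK // (Hsq i).2; congr (_ * _).
  rewrite /G linear_sum; apply: eq_big_seq => q qs /=.
  by rewrite gram_poly_rank1 poly_of_rowK //; apply: (Hsq i).1.
apply/truncated_qmoduleP; exists (fun i => gram_poly (d i) (vsval (A i))).
split=> // i; apply/SigmaP.
have [r [G ->]] := psd_gram (sym_block A i) (KA i).
exists [seq poly_of_row (d i) (row a G) | a <- enum 'I_r]; split.
  by move=> _ /mapP[a _ ->]; apply: msize_poly_of_row.
rewrite big_map big_enum sum_gram_rows linear_sum; apply: eq_bigr => a _.
exact: gram_poly_rank1.
Qed.

End UpperBound.

Lemma sxdeg_eq (R : realType) (V : lmodType R) (S : set V) (j : nat) :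
  (0 < j)%N -> has_psd_lift S j ->
  (forall i, (0 < i)%N -> has_psd_lift S i -> (j <= i)%N) -> sxdeg S = j%:E.
Proof.
move=> j0 Sj minj; rewrite /sxdeg; case: pselect => [h|[]]; last first.
  by exists j; rewrite j0; apply/asboolP.
case: ex_minnP => i /andP[i0 /asboolP Si] mini; congr (_%:E).
by apply/eqP; rewrite eqn_leq minj // mini // j0; apply/asboolP.
Qed.

Section LiftSize.
Variables (R : realType) (n : nat).

Definition evaluation (x : 'rV[R]_n) (p : {mpoly R[n]}) : R^o :=
  p.@[fun l => x ord0 l].

Lemma evaluation_is_linear x : linear (evaluation x).
Proof. by move=> c p q; rewrite /evaluation mevalD mevalZ. Qed.

HB.instance Definition _ x :=
  GRing.isLinear.Build R {mpoly R[n]} R^o _ (evaluation x)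
    (evaluation_is_linear x).

Variables (k : nat) (g : 'I_k -> {mpoly R[n]}) (d : 'I_k.+1 -> nat).

Lemma truncated_qmodule_ge0 x p : semialg_set g x ->
  truncated_qmodule g d p -> 0 <= evaluation x p.
Proof.
move=> Xx /truncated_qmoduleP[s [Ss ->]]; rewrite linear_sum.
apply: sumr_ge0 => i _; rewrite /= /evaluation mevalM mulr_ge0 //.
  by rewrite /multiplier; case: unliftP => [l _|_]; [apply: Xx|rewrite meval1].
have [[t ->] _] := Ss i; rewrite raddf_sum; apply: sumr_ge0 => q _ /=.
by rewrite expr2 mevalM -expr2 sqr_ge0.
Qed.

Lemma multiplier_sqr_mem i f : (msize f <= (d i).+1)%N ->
  truncated_qmodule g d (multiplier g i * f ^+ 2).
Proof.
move=> fd; apply/truncated_qmoduleP.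
exists (fun l => if l == i then f ^+ 2 else 0); split=> [l|].
  apply/SigmaP; case: eqP => [->|_].
    exists [:: f]; rewrite big_seq1; split=> // q; by rewrite inE => /eqP ->.
  by exists [::]; rewrite big_nil.
rewrite (bigD1 i) //= eqxx big1 ?addr0 // => l /negbTE ->; exact: mulr0.
Qed.

(** [lift_separation] against more points of [X] in general position than it
allows.  They are taken outside the zeros of the product [h] of the [g i], so
that multiplying the square of a separating polynomial by [multiplier g i0]
keeps it nonzero at [x]. *)
Lemma truncated_qmodule_lift_size (j : nat) : (forall i, g i != 0) ->
  (semialg_set g)° !=set0 -> (0 < j)%N ->
  has_psd_lift (truncated_qmodule g d) j ->
  ('C(n + \max_(i < k.+1) d i, n) <= j)%N.
Proof.
move=> g0 [z /nbhs_ballP[eps /= eps0 Xball]] j0 [m m0 lift].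
have [|i0 ->] := @bigop.eq_bigmax 'I_k.+1 d; first by rewrite card_ord.
rewrite leqNgt; apply/negP => jlt.
set C := 'C(_, n) in jlt; pose h : {mpoly R[n]} := \prod_i g i.
have h0 : h != 0 by apply/prodf_neq0.
have kC : (0 < C.-1 < C)%N by lia.
have [s [szs us gps nears]] :=
  general_position_near (separation_bound m C.-1).+1 z kC eps0 h0.
have Xs x : x \in s -> semialg_set g x.
  move=> xs; apply: Xball; split=> // a l; rewrite [a]ord1.
  by rewrite /ball /= distrC; apply: (nears x xs).1.
have /negP[] : ~~ (size s <= separation_bound m C.-1)%N by rewrite szs ltnn.
apply: (lift_separation (ell := evaluation) lift) => //; [lia|lia| |].
  by move=> x p xs; apply: truncated_qmodule_ge0; apply: Xs.
move=> x W xs Ws szW xW; have [f [fd fx fW]] := gps x W xs Ws szW xW.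
exists (multiplier g i0 * f ^+ 2); first exact: multiplier_sqr_mem.
rewrite /= /evaluation expr2; split; last first.
  by move=> y yW; rewrite !mevalM fW // mul0r mulr0.
rewrite !mevalM !mulf_neq0 // /multiplier.
case: unliftP => [l _|_]; last by rewrite meval1 oner_neq0.
have := (nears x xs).2; apply: contraNneq => gl.
by rewrite /h (bigD1 l) //= mevalM gl mul0r.
Qed.

End LiftSize.

Theorem corollary5 (R : realType) (n k : nat) (hn : (0 < n)%N) (hk : (0 < k)%N)
    (g : 'I_k -> {mpoly R[n]}) (hg : forall i : 'I_k, g i != 0)
    (hX : (semialg_set g)° !=set0)
    (d : 'I_k.+1 -> nat) :
  sxdeg (truncated_qmodule g d) =
    ('C(n + \max_(i < k.+1) d i, n))%:E.
Proof.
apply: sxdeg_eq.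
- by rewrite bin_gt0 leq_addr.
- rewrite -card_bounded_monomials; apply: truncated_qmodule_lift => i.
  exact: leq_bigmax.
- by move=> j; apply: truncated_qmodule_lift_size.
Qed.
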